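(* Let $n>0$ be an integer and let $I$ denote the $2^n\times2^n$ identity matrix. Then for all $\varepsilon\in(0,1/2)$, $$\mathsf{rk}^{+}_{\varepsilon}(I)\le\frac{16n}{\varepsilon^2}.$$
   Context: For a real matrix $M$ and $\varepsilon\ge0$, the $\varepsilon$-approximate nonnegative-rank $\mathsf{rk}^{+}_{\varepsilon}(M)$ is the minimum number of entrywise nonnegative rank-1 matrices whose sum $M'$ satisfies $|M'_{ij}-M_{ij}|\le\varepsilon$ for all $i,j$. *)

(* Defs.v *)
From mathcomp Require Import all_boot all_order all_algebra.
From mathcomp Require Import boolp reals constructive_ereal.

Set Implicit Arguments.
Unset Strict Implicit.
Unset Printing Implicit Defensive.

Import Order.TTheory GRing.Theory Num.Theory.
Local Open Scope ring_scope.

Definition nonneg_mx (R : realType) (p q : nat) (A : 'M[R]_(p, q)) : Prop :=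
  forall i j, 0 <= A i j.

Definition approx_nnfactorizable (R : realType) (p q : nat) (eps : R)
    (M : 'M[R]_(p, q)) (k : nat) : Prop :=
  exists A : 'I_k -> 'M[R]_(p, q),
    (forall t, nonneg_mx (A t) /\ \rank (A t) = 1%N) /\
    (forall i j, `|(\sum_t A t) i j - M i j| <= eps).

(* The value is +oo when no number of matrices works, which happens exactly
   when M has an entry smaller than - eps (for 0 <= eps). *)
Definition approx_nnrank (R : realType) (p q : nat) (eps : R)
    (M : 'M[R]_(p, q)) : \bar R :=
  match pselect (exists k, `[< approx_nnfactorizable eps M k >]) with
  | left ex_k => (ex_minn ex_k)%:R%:E
  | right _ => +oo%E
  end.

(* Main.v *)
Require Import Defs.
From mathcomp Require Import all_boot all_order all_algebra.
From mathcomp Require Import boolp reals constructive_ereal.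
From mathcomp Require Import lra.

Import Order.TTheory GRing.Theory Num.Theory.
Local Open Scope ring_scope.

(* Let $c_1, ..., c_N$, $N = 2^n$, be words of length $m$ over an alphabet of
   size $q$, any two of which agree in fewer than $n$ positions. The $mq$
   rank-1 matrices $m^{-1} [c_i(t) = a] [c_j(t) = a]$, indexed by $(t, a)$, sum
   to the matrix of agreement frequencies, which is $1$ on the diagonal and at
   most $(n-1)/m$ elsewhere. With $m$ and $q$ the integer parts of
   $n/\varepsilon$ and $16/\varepsilon$, that is at most $\varepsilon$, and
   the greedy (Gilbert-Varshamov) argument produces such words because
   $2^n \binom{m}{n} \le q^n$. *)

(** While fewer than [N] words are chosen, their balls cover at most [N.-1 * d] elements, so some
    element is left. New words go to the head of the list, so the ball to avoid is centred at the
    later entry: hence [e y x]. *)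
Lemma greedy_code (T : finType) (e : rel T) (d N : nat) :
    (forall x, #|e x| <= d)%N -> (N.-1 * d < #|T|)%N ->
  exists s : seq T, size s = N /\ pairwise (fun x y => ~~ e y x) s.
Proof.
move=> ball_le.
elim: N => [|N IHN] /= Nd_lt; first by exists [::].
have [|s [sizes codes]] := IHN.
  by apply: leq_ltn_trans Nd_lt; rewrite leq_mul2r leq_pred orbT.
pose U := [set y | has (fun x => e x y) s].
have cardU : (#|U| <= size s * d)%N.
  rewrite {}/U {sizes codes}; elim: s => [|x s IHs] /=.
    by rewrite eq_card0 // => y; rewrite inE.
  have -> : [set y | e x y || has (e^~ y) s] =
            [set y | e x y] :|: [set y | has (e^~ y) s].
    by apply/setP => y; rewrite !inE.
  rewrite (leq_trans (leq_card_setU _ _)) // mulSn leq_add //.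
  by rewrite cardsE.
have /card_gt0P [y] : (0 < #|~: U|)%N.
  by rewrite cardsCs setCK subn_gt0 (leq_ltn_trans cardU) ?sizes.
rewrite !inE => yU; exists (y :: s); rewrite /= sizes codes andbT; split=> //.
by rewrite all_predC.
Qed.

Lemma card_ffun_agree (A B : finType) (S : {set A}) (f : {ffun A -> B}) :
  #|[set g : {ffun A -> B} | [forall t in S, f t == g t]]| = (#|B| ^ (#|A| - #|S|))%N.
Proof.
(* The set is a product: one allowed value at each position of [S], all of [B] elsewhere. *)
pose F t := if t \in S then pred1 (f t) else predT.
transitivity #|(family F : simpl_pred {dffun forall _ : A, B})|.
  apply: eq_card => g; rewrite !inE; apply/forall_inP/familyP => agree t.
    by rewrite /F; case: ifP => [/agree|//]; rewrite inE eq_sym.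
  by move=> tS; have := agree t; rewrite /F tS inE eq_sym.
rewrite card_family foldrE big_map big_enum /= (bigID (mem S)) /=.
rewrite big1 ?mul1n => [|t tS]; last by rewrite /F tS card1.
rewrite (eq_bigr (fun=> #|B|)) => [|t /negPf tS]; last by rewrite /F tS.
by rewrite prod_nat_const -(cardC S) addKn; congr (_ ^ _)%N; apply: eq_card.
Qed.

Definition agreement {A B : finType} (f g : {ffun A -> B}) : nat :=
  #|[set t | f t == g t]|.

(** Union bound over the [n]-subsets [S] of positions on which [g] is forced to equal [f]. *)
Lemma card_agreement_ball (A B : finType) (f : {ffun A -> B}) (n : nat) :
  (#|[pred g | n <= agreement f g]| <= 'C(#|A|, n) * #|B| ^ (#|A| - n))%N.
Proof.
pose U := \bigcup_(S : {set A} | #|S| == n)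
  [set g : {ffun A -> B} | [forall t in S, f t == g t]].
have /subset_leq_card/leq_trans -> // : [pred g | (n <= agreement f g)%N] \subset U.
  apply/subsetP => g; rewrite inE => /card_geqP [s [uniqs sizes sub]].
  apply/bigcupP; exists [set t in s]; first by rewrite cardsE (card_uniqP uniqs) sizes.
  by rewrite inE; apply/forall_inP => t; rewrite inE => /sub; rewrite inE.
apply: (@leq_trans (\sum_(S : {set A} | #|S| == n) #|B| ^ (#|A| - n))%N); last first.
  by rewrite sum_nat_const -card_draws cardsE.
rewrite /U; elim/big_rec2: _ => [|S k V /eqP cardS leVk]; first by rewrite cards0.
by rewrite (leq_trans (leq_card_setU _ _)) // leq_add // card_ffun_agree cardS.
Qed.

Lemma bin_le_exp2 (m n : nat) : ('C(m, n) <= 2 ^ m)%N.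
Proof.
elim: m n => [|m IHm] [|n] //; first by rewrite bin0 expn_gt0.
by rewrite binS expnS mul2n -addnn leq_add.
Qed.

Lemma expn_le_ffact (m n : nat) : (m ^ n <= (m + n) ^_ n)%N.
Proof.
elim: n => [|n IHn]; first by rewrite ffactn0.
by rewrite addnS ffactSS expnS leq_mul // ltnW // ltnS leq_addr.
Qed.

Lemma ffact_le_expn (m n : nat) : (m ^_ n <= m ^ n)%N.
Proof.
elim: n => [|n IHn]; first by rewrite ffactn0.
by rewrite ffactnSr expnSr leq_mul // leq_subr.
Qed.

(** A weak Stirling bound: $n^n \le (2n)!/n! = \binom{2n}{n} n!$, and the binomial is at most
    $4^n$. *)
Lemma expn_le_fact (n : nat) : (n ^ n <= 4 ^ n * n`!)%N.
Proof.
rewrite (leq_trans (expn_le_ffact n n)) // -bin_ffact leq_mul //.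
by rewrite -[4%N]/(2 ^ 2)%N -expnM mul2n -addnn bin_le_exp2.
Qed.

(** For $n > 0$, $\binom{m}{n} \le m^n/n! \le (4m/n)^n$; the factor $2^n$ turns the 4 into the 8 of
    the hypothesis. *)
Lemma bin_mul_exp2_le (m n q : nat) :
  (8 * m <= q * n)%N -> (2 ^ n * 'C(m, n) <= q ^ n)%N.
Proof.
move=> mq; have fact4_gt0 : (0 < 4 ^ n * n`!)%N by rewrite muln_gt0 fact_gt0 expn_gt0.
rewrite -(leq_pmul2r fact4_gt0) mulnACA -expnMn bin_ffact.
apply: (@leq_trans ((8 * m) ^ n)%N).
  by rewrite (expnMn 8) leq_mul // ffact_le_expn.
apply: (@leq_trans ((q * n) ^ n)%N); first by case: (n) mq => // n' mq; rewrite leq_exp2r.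
by rewrite expnMn leq_mul // expn_le_fact.
Qed.

Section NonnegativeRank.
Context {R : realType}.

Lemma approx_nnrank_le (p q : nat) (eps : R) (M : 'M[R]_(p, q)) (k : nat) :
  approx_nnfactorizable eps M k -> (approx_nnrank eps M <= k%:R%:E)%E.
Proof.
move=> Mk; rewrite /approx_nnrank; case: pselect => [ex_k|[]]; last first.
  by exists k; apply/asboolP.
case: ex_minnP => k' _ k'_min; rewrite lee_fin ler_nat.
by apply: k'_min; apply/asboolP.
Qed.

(** Summands must have rank exactly 1, so the zero matrices are dropped; this keeps the sum and can
    only lower the count. *)
Lemma approx_nnfactorizable_sum (T : finType) (p q : nat) (eps : R)
    (M : 'M[R]_(p, q)) (B : T -> 'M[R]_(p, q)) :
    (forall x, nonneg_mx (B x)) -> (forall x, \rank (B x) <= 1)%N ->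
    (forall i j, `|(\sum_x B x) i j - M i j| <= eps) ->
  exists2 k, (k <= #|T|)%N & approx_nnfactorizable eps M k.
Proof.
move=> B_ge0 rankB sumB; pose S := [set x | B x != 0].
exists #|S|; first exact: max_card.
exists (fun t => B (enum_val t)); split=> [t|i j].
  split=> //; apply/eqP; rewrite eqn_leq rankB lt0n mxrank_eq0.
  by have := enum_valP t; rewrite inE.
rewrite -(big_enum_val (A := mem S) B).
have -> : \sum_(x in S) B x = \sum_x B x; last exact: sumB.
rewrite [RHS](bigID (mem S)) /= [X in _ = _ + X]big1 ?addr0 // => x.
by rewrite inE negbK => /eqP.
Qed.

Lemma identity_factorizable_of_code (A B : finType) (N n : nat) (eps : R)
    (c : 'I_N -> {ffun A -> B}) :
    (0 < #|A|)%N -> 0 <= eps -> n%:R <= eps * #|A|%:R ->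
    (forall i j, i != j -> (agreement (c i) (c j) <= n)%N) ->
  exists2 k, (k <= #|A| * #|B|)%N & approx_nnfactorizable eps (1%:M : 'M[R]_N) k.
Proof.
move=> A_gt0 eps_ge0 n_le c_agree.
pose m : R := #|A|%:R; have m_gt0 : 0 < m by rewrite ltr0n.
pose u (x : A * B) : 'cV[R]_N := \col_i (c i x.1 == x.2)%:R.
pose D x := m^-1 *: (u x *m (u x)^T).
have DE x i j : D x i j = m^-1 * ((c i x.1 == x.2) && (c j x.1 == x.2))%:R.
  by rewrite !mxE big_ord1 !mxE -natrM mulnb.
have sumDE i j : (\sum_x D x) i j = (agreement (c i) (c j))%:R / m.
  rewrite summxE; under eq_bigr do rewrite DE.
  rewrite -mulr_sumr mulrC -natr_sum; congr (_%:R / _).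
  rewrite /agreement -sum1_card [RHS]big_mkcond /=.
  (* At a fixed position [t], only the letter [a = c i t] can contribute. *)
  rewrite -(pair_bigA _ (fun t a => ((c i t == a) && (c j t == a) : nat))) /=.
  apply: eq_bigr => t _; rewrite inE (bigD1 (c i t)) //= eqxx eq_sym big1 => [|a].
    by rewrite addn0; case: eqP.
  by rewrite eq_sym => /negPf->.
rewrite -card_prod; apply: (@approx_nnfactorizable_sum _ _ _ _ _ D).
- by move=> x i j; rewrite DE mulr_ge0 ?invr_ge0 ?ler0n.
- move=> x; rewrite (leq_trans (mxrank_scale _ _)) //.
  by rewrite (leq_trans (mxrankM_maxl _ _)) ?rank_leq_col.
move=> i j; rewrite sumDE mxE; have [<-|neq_ij] := eqVneq i j.
  have -> : agreement (c i) (c i) = #|A|.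
    by rewrite /agreement -cardsT; apply: eq_card => t; rewrite !inE eqxx.
  by rewrite divff ?subrr ?normr0 // gt_eqF.
rewrite subr0 ger0_norm ?divr_ge0 ?ler0n // ler_pdivrMr //.
by apply: le_trans n_le; rewrite ler_nat c_agree.
Qed.

End NonnegativeRank.

Theorem corollary1p8 (R : realType) (n : nat) (hn : (0 < n)%N) (eps : R)
    (heps0 : 0 < eps) (heps1 : eps < 1 / 2) :
  (approx_nnrank eps (1%:M : 'M[R]_(2 ^ n)) <= (16 * n%:R / eps ^+ 2)%:E)%E.
Proof.
pose m := Num.truncn (n%:R / eps); pose q := Num.truncn (16 / eps).
have n_ge1 : 1 <= n%:R :> R by rewrite ler1n.
have /andP[m_le m_gt] : m%:R <= n%:R / eps < m.+1%:R.
  by apply: truncn_itv; rewrite divr_ge0 // ltW.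
have /andP[q_le q_gt] : q%:R <= 16 / eps < q.+1%:R.
  by apply: truncn_itv; rewrite divr_ge0 // ltW.
have eps2 : 2 < eps^-1 by rewrite -[2]invrK ltf_pV2 ?posrE //; lra.
rewrite -natr1 in m_gt; rewrite -(natr1 q) in q_gt.
(* Since $\varepsilon < 1/2$, $m + 1 > n/\varepsilon > 2n$. *)
have nm : (n <= m)%N by rewrite -(ler_nat R); nra.
(* It suffices that $q \ge 8/\varepsilon$; taking 16 in place of 8 absorbs the rounding of [q]. *)
have mq : (8 * m <= q * n)%N by rewrite -(ler_nat R) !natrM; nra.
have q_gt0 : (0 < q)%N by rewrite -(ltr_nat R); nra.
(* Rounding [m] down costs $\varepsilon m$ less than $\varepsilon < 1$, which is why words may agree
   in only [n.-1] positions. *)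
have m_large : n.-1%:R <= eps * m%:R.
  have n_eq : n%:R = n.-1%:R + 1 :> R by rewrite natr1 prednK.
  rewrite ltr_pdivrMr // in m_gt; nra.
pose word := {ffun 'I_m -> 'I_q}.
pose close (f g : word) := (n <= agreement f g)%N.
have card_close f : (#|close f| <= 'C(m, n) * q ^ (m - n))%N.
  by have := card_agreement_ball _ _ f n; rewrite !card_ord.
have [|s [sizes codes]] := @greedy_code word close _ (2 ^ n) card_close.
  (* After cancelling $q^{m-n}$, it remains that $(2^n - 1)\binom{m}{n} < 2^n\binom{m}{n} \le
     q^n$. *)
  rewrite card_ffun !card_ord -[m in (_ < _ ^ m)%N](subnKC nm) expnD.
  rewrite mulnA ltn_pmul2r ?expn_gt0 ?q_gt0 //.
  apply: leq_trans (bin_mul_exp2_le _ _ _ mq).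
  by rewrite ltn_pmul2r ?bin_gt0 // ltn_predL expn_gt0.
(* Default for [nth], never reached since [s] has size $2^n$. *)
have f0 : word by exact: [ffun=> Ordinal q_gt0].
have c_agree (i j : 'I_(2 ^ n)) : i != j ->
    (agreement (nth f0 s i) (nth f0 s j) <= n.-1)%N.
  have agreeC (f g : word) : agreement f g = agreement g f.
    by apply: eq_card => t; rewrite !inE eq_sym.
  wlog lt_ij : i j / (i < j)%N.
    move=> IH neq_ij; have [/IH->//|lt_ji|eq_ij] := ltngtP i j.
      by rewrite agreeC IH // eq_sym.
    by rewrite (val_inj eq_ij) eqxx in neq_ij.
  move=> _; have /(pairwiseP f0) /(_ i j) := codes.
  rewrite !inE sizes !ltn_ord => /(_ isT isT lt_ij).
  by rewrite /close agreeC -ltnNge -[(_ <= n.-1)%N]ltnS prednK.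
have m_gt0 : (0 < m)%N := leq_trans hn nm.
have [||||k k_le fact_k] := @identity_factorizable_of_code R 'I_m 'I_q _ n.-1 eps
  (fun i : 'I_(2 ^ n) => nth f0 s i).
- by rewrite card_ord.
- exact: ltW.
- by rewrite card_ord.
- exact: c_agree.
apply: le_trans (approx_nnrank_le _ _ _ _ _ fact_k) _; rewrite lee_fin.
rewrite !card_ord in k_le.
apply: (@le_trans _ _ (m * q)%:R); first by rewrite ler_nat.
have -> : 16 * n%:R / eps ^+ 2 = (n%:R / eps) * (16 / eps).
  by rewrite expr2 invfM; lra.
by rewrite natrM ler_pM.
Qed.
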